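(* Let $\mathcal{X}\subseteq\{0,1\}^n$ be nonempty. The heuristic that computes, for the sets $\mathcal{U}_1,\ldots,\mathcal{U}_K$, the solutions $$\pmb{x}^{(k)}\in\operatorname*{arg\,min}_{\pmb{x}\in\mathcal{X}}\ \max_{\pmb{c}\in\mathcal{U}_k}\pmb{c}^\top\pmb{x}\qquad\text{for all } k\in\{1,\ldots,K\}$$ and returns $\pmb{x}^{(1)},\ldots,\pmb{x}^{(K)}$ requires the solution of $\mathcal{O}(K(2+t)n)$ many deterministic problems, where $t=\lfloor n/K\rfloor$.
   Context: Given are integers $1\le K\le n$ and $\Gamma\ge 1$, a nominal vector $\hat{\pmb{c}}\in\mathbb{R}^n$, deviations $\pmb{d}\in\mathbb{R}^n_{\ge 0}$, and $t:=\lfloor n/K\rfloor$. For $k=1,\ldots,K-1$ let $$\mathcal{U}_k:=\Big\{\pmb{c}\in\mathbb{R}^n:\ c_i=\hat c_i+\delta_i d_i\ (i=1,\ldots,n),\ \pmb{\delta}\in\{0,1\}^n,\ \sum_{i=1}^{(k-1)t}\delta_i=0,\ \sum_{i=(k-1)t+1}^{kt}\delta_i\ge 1,\ \sum_{i=(k-1)t+1}^{n}\delta_i\le\Gamma\Big\}$$ and $$\mathcal{U}_K:=\Big\{\pmb{c}\in\mathbb{R}^n:\ c_i=\hat c_i+\delta_i d_i\ (i=1,\ldots,n),\ \pmb{\delta}\in\{0,1\}^n,\ \sum_{i=1}^{(K-1)t}\delta_i=0,\ \sum_{i=(K-1)t+1}^{n}\delta_i\ge 1,\ \sum_{i=(K-1)t+1}^{n}\delta_i\le\Gamma\Big\}.$$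 A ''deterministic problem'' is a problem $\min_{\pmb{x}\in\mathcal{X}}\pmb{c}^\top\pmb{x}$ for a fixed cost vector $\pmb{c}\in\mathbb{R}^n$. ''Requires the solution of $\mathcal{O}(N)$ many deterministic problems'' means that the heuristic's output can be computed using $\mathcal{O}(N)$ calls to an oracle solving deterministic problems over $\mathcal{X}$. *)

(* Defs.v *)
From mathcomp Require Import all_boot all_order all_algebra.
From mathcomp Require Import boolp classical_sets reals.

Set Implicit Arguments.
Unset Strict Implicit.
Unset Printing Implicit Defensive.

Import Order.TTheory GRing.Theory Num.Theory.
Local Open Scope ring_scope.
Local Open Scope classical_set_scope.

(* Elements of {0,1}^n. *)
Notation bits n := {ffun 'I_n -> bool}.

Definition cost (R : realType) (n : nat) (c : 'rV[R]_n) (x : bits n) : R :=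
  \sum_(i < n) c 0 i * (x i)%:R.

Definition is_argmin (T : finType) (R : realType) (X : {set T}) (f : T -> R)
    (x : T) : Prop :=
  x \in X /\ forall y, y \in X -> f x <= f y.

(* Positions are 0-based: [i : 'I_n] is the coordinate i+1 of the usual
   numbering, so the sums over 1..lo, lo+1..hi and lo+1..n become the sums over
   i < lo, lo <= i < hi and lo <= i. *)
Definition admissible (n Gamma lo hi : nat) (delta : bits n) : Prop :=
  [/\ (\sum_(i < n | i < lo) delta i = 0)%N,
      (1 <= \sum_(i < n | lo <= i < hi) delta i)%N &
      (\sum_(i < n | lo <= i) delta i <= Gamma)%N].

Definition uncertainty (R : realType) (n Gamma : nat) (chat d : 'rV[R]_n)
    (lo hi : nat) : set 'rV[R]_n :=
  [set c : 'rV[R]_n | exists2 delta : bits n, admissible Gamma lo hi delta &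
           forall i, c 0 i = chat 0 i + (delta i)%:R * d 0 i].

(* [k] is 0-based: [U K Gamma chat d k] is the (k+1)-st of the K sets. With
   t = n %/ K, its block is k*t+1..(k+1)*t, except that the block of the last
   set extends to n. *)
Definition U (R : realType) (n K Gamma : nat) (chat d : 'rV[R]_n) (k : nat) :
    set 'rV[R]_n :=
  let t := (n %/ K)%N in
  uncertainty Gamma chat d (k * t) (if k.+1 == K then n else (k.+1 * t)%N).

(* The supremum is a maximum for the sets [U], see [worst_case_max]. *)
Definition worst_case (R : realType) (n : nat) (V : set 'rV[R]_n)
    (x : bits n) : R :=
  sup [set cost c x | c in V].

(* Adaptive computations with access to an oracle: queries have type Q, answers
   type A, and the result type B. All information about the problem that is not
   a parameter of the computation has to be obtained through [Ask]; the
   computations between two queries are not charged. *)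
Inductive oracle_alg (Q A B : Type) : Type :=
| Return of B
| Ask of Q & (A -> oracle_alg Q A B).

Fixpoint run (Q A B : Type) (O : Q -> A) (p : oracle_alg Q A B) : B :=
  match p with
  | Return b => b
  | Ask q next => run O (next (O q))
  end.

Fixpoint ncalls (Q A B : Type) (O : Q -> A) (p : oracle_alg Q A B) : nat :=
  match p with
  | Return _ => 0
  | Ask q next => (ncalls O (next (O q))).+1
  end.

Definition deterministic_oracle (R : realType) (n : nat) (X : {set bits n})
    (O : 'rV[R]_n -> bits n) : Prop :=
  forall c, is_argmin X (cost c) (O c).

Lemma uncertainty_max (R : realType) (n Gamma : nat) (chat d : 'rV[R]_n)
    (lo hi : nat) (x : bits n) :
  (0 < Gamma)%N -> (lo < hi)%N -> (hi <= n)%N ->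
  let V := uncertainty Gamma chat d lo hi in
  (exists2 c, V c & worst_case V x = cost c x) /\
  (forall c, V c -> cost c x <= worst_case V x).
Proof.
move=> G0 lohi hin V; have lon := leq_trans lohi hin.
pose f (e : bits n) : 'rV[R]_n := \row_i (chat 0 i + (e i)%:R * d 0 i).
have fE (c : 'rV[R]_n) (e : bits n) :
    (forall i, c 0 i = chat 0 i + (e i)%:R * d 0 i) -> c = f e.
  by move=> h; apply/rowP => i; rewrite mxE h.
have Vf (e : bits n) : admissible Gamma lo hi e -> V (f e).
  by move=> ae; exists e => // i; rewrite mxE.
pose e0 : bits n := [ffun i => i == Ordinal lon].
have e0s (P : pred 'I_n) : P (Ordinal lon) ->
    (\sum_(i < n | P i) e0 i = 1)%N.
  move=> P0; rewrite (bigD1 (Ordinal lon)) //= ffunE eqxx big1 // => i.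
  by case/andP=> _ /negbTE h; rewrite ffunE h.
pose P (e : bits n) := `[< admissible Gamma lo hi e >].
have a0 : P e0.
  apply/asboolP; split; last 1 first.
  - by rewrite (e0s (fun i : 'I_n => (lo <= i)%N)) /=.
  - rewrite big1 // => i ilo; rewrite ffunE; case: eqP => // h.
    by rewrite h /= ltnn in ilo.
  - by rewrite (e0s (fun i : 'I_n => (lo <= i < hi)%N)) //= leqnn.
case: (@arg_maxP _ _ _ e0 P (fun e => cost (f e) x) a0) => e /asboolP ae emax.
have ubV : ubound [set cost c x | c in V] (cost (f e) x).
  move=> _ [c [e' ae' /fE ->] <-]; apply: emax; exact/asboolP.
have supE : worst_case V x = cost (f e) x.
  apply/eqP; rewrite eq_le; apply/andP; split.
    by apply: ge_sup => //; exists (cost (f e) x), (f e) => //; exact: Vf.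
  by apply: ub_le_sup; [exists (cost (f e) x) | exists (f e) => //; exact: Vf].
split; first by exists (f e) => //; exact: Vf.
by move=> c Vc; rewrite supE; apply: ubV; exists c.
Qed.

Lemma worst_case_max (R : realType) (n K Gamma : nat) (chat d : 'rV[R]_n)
    (k : 'I_K) (x : bits n) :
  (K <= n)%N -> (0 < Gamma)%N ->
  let V := U K Gamma chat d k in
  (exists2 c, V c & worst_case V x = cost c x) /\
  (forall c, V c -> cost c x <= worst_case V x).
Proof.
move=> Kn G0; have K0 : (0 < K)%N by apply: leq_ltn_trans (ltn_ord k).
have t0 : (0 < n %/ K)%N by rewrite divn_gt0.
have le_n : (k.+1 * (n %/ K) <= n)%N.
  by apply: leq_trans (leq_divM n K); rewrite mulnC leq_mul2l ltn_ord orbT.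
have lt_t : (k * (n %/ K) < k.+1 * (n %/ K))%N by rewrite ltn_mul2r t0 ltnSn.
apply: uncertainty_max => //; case: ifP => // _; exact: leq_trans le_n.
Qed.

(* Main.v *)
Require Import Defs.
From mathcomp Require Import all_boot all_order all_algebra.
From mathcomp Require Import reals.
From mathcomp Require Import lra.

(** For a fixed solution [x] and a block [B] of the set [S] of coordinates
    allowed to deviate, the adversary picks [T] inside [S] with [#|T| <= Gamma]
    that meets [B], and gains the sum over [T] of [w i = d i * x i].  The
    constraints of this selection problem form a laminar family, so it has no
    duality gap: its value is the minimum over [0 <= sigma <= pi] of
      (Gamma - 1) pi + sigma
        + sum_(i in B) max 0 (w i - sigma) + sum_(i in S \ B) max 0 (w i - pi),
    where [pi] is the price of the budget [Gamma] and [pi - sigma] the price of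
    the requirement that [T] meet [B].  As [x] is a 0/1 vector and the prices
    are nonnegative, [max 0 (w i - p) = max 0 (d i - p) * x i]; for fixed
    prices, the dual objective is therefore a constant plus a deterministic
    cost of [x].

    It remains to see that few prices suffice for all [x] together
    ([optimal_prices]).  If an unconstrained best choice of [Gamma] elements of
    [S] can be made to meet [B], then [sigma = pi] is the usual threshold, equal
    to [0] or to some [d i].  Otherwise the best choice is the largest element
    of [B] together with the [Gamma - 1] largest elements outside [B], and
    [sigma] is [0] or some [d i] with [i] in [B].  The second case cannot occur
    for the last set, whose block is all of [S]; in the other cases [B] has
    [t] elements.  This leaves [(n + 1) * (t + 2)] price pairs for each of the
    [K] sets.

    The computation asks for a minimizer for each pair and, for each set,
    returns an answer of least worst-case cost.  It is optimal: let [x] be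
    feasible and take the prices that are exact for [x]; the answer [y] to that
    query has worst case at most its dual objective ([weak_duality]), which is
    at most that of [x], which is the worst case of [x] ([strong_duality]). *)

Set Implicit Arguments.
Unset Strict Implicit.
Unset Printing Implicit Defensive.

Import Order.TTheory GRing.Theory Num.Theory.
Local Open Scope ring_scope.

(** * Optimal prices for selecting a set that meets a block *)

Lemma max_elt (I : finType) (R : realDomainType) (w : I -> R) (A : {set I}) :
  A != set0 -> exists2 i, i \in A & forall j, j \in A -> w j <= w i.
Proof.
by case/set0Pn=> a aA; case: (arg_maxP w aA) => i iA imax; exists i.
Qed.

Lemma largest_subset (I : finType) (R : realDomainType) (w : I -> R)
    (A : {set I}) (m : nat) :
  exists T : {set I}, [/\ T \subset A, (#|T| <= m)%N,
    (#|T| = m \/ A :\: T = set0) &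
    forall i j, i \in T -> j \in A :\: T -> w j <= w i].
Proof.
elim: m => [|m [T [TA Tm full top]]].
  exists set0; split; [exact: sub0set|by rewrite cards0|by left; rewrite cards0|].
  by move=> i j; rewrite inE.
have [AT0|/(max_elt w) [a aAT amax]] := eqVneq (A :\: T) set0.
  by exists T; split=> //; [exact: leqW|right].
have [aT aA] : a \notin T /\ a \in A by move: aAT; rewrite inE => /andP.
have cT : #|T| = m by case: full => // AT0; rewrite AT0 inE in aAT.
exists (a |: T); rewrite cardsU1 aT cT; split=> //.
- by rewrite subUset sub1set aA.
- by left.
- move=> i j; rewrite !inE negb_or => /orP[/eqP->|iT] /andP[/andP[_ jT] jA].
    by apply: amax; rewrite inE jT.
  by apply: top; rewrite // inE jT.
Qed.

(** The price [pi] of a budget of [m] elements: complementary slackness with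
    the selection [T], which uses up the budget unless it is free. *)
Lemma threshold_price (I : finType) (R : realDomainType) (w : I -> R)
    (A : {set I}) (m : nat) :
  (forall i, 0 <= w i) ->
  exists (T : {set I}) (pi : R),
    [/\ T \subset A, (#|T| <= m)%N & #|T| = m \/ pi = 0] /\
    [/\ pi = 0 \/ (exists2 i, i \in A & pi = w i),
        forall i, i \in T -> pi <= w i &
        forall i, i \in A -> i \notin T -> w i <= pi].
Proof.
move=> w0; have [T [TA Tm full top]] := largest_subset w A m.
have [AT0|/(max_elt w) [a aAT amax]] := eqVneq (A :\: T) set0.
  exists T, 0; split; split=> //; [by right|by left|].
  by move=> i iA iT; have := in_set0 i; rewrite -AT0 inE iT iA.
exists T, (w a); split; split=> //.
- by left; case: full => // AT0; rewrite AT0 inE in aAT.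
- by right; exists a => //; move: aAT; rewrite inE => /andP[].
- by move=> i iT; exact: top.
- by move=> i iA iT; apply: amax; rewrite inE iT.
Qed.

(** Complementary slackness for the selection problem of a set [T] of at most
    [G] elements of [S] that meets [B].  The last conclusion is what limits the
    number of prices to be tried: two independent prices are used only if the
    block is a proper subset. *)
Lemma optimal_prices (I : finType) (R : realDomainType) (w : I -> R)
    (B S : {set I}) (G : nat) :
  B \subset S -> B != set0 -> (0 < G)%N -> (forall i, 0 <= w i) ->
  exists (T : {set I}) (pi sigma : R),
    let p i := if i \in B then sigma else pi in
    [/\ T \subset S, (#|T| <= G)%N & exists2 i, i \in T & i \in B] /\
    [/\ forall i, i \in T -> p i <= w i,
        forall i, i \in S -> i \notin T -> w i <= p i &
        \sum_(i in T) p i = G.-1%:R * pi + sigma] /\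
    (pi = 0 \/ exists2 i, i \in S & pi = w i) /\
    (sigma = pi \/
      [/\ sigma <= pi, B != S & exists2 i, i \in B & sigma = w i]).
Proof.
move=> BS Bn0 G0 w0.
have GE (a : R) : G.-1%:R * a + a = a *+ G.
  by rewrite mulr_natl -mulrSr prednK.
have [T [pi [[TS TG full] [piE onT offT]]]] := threshold_price S G w0.
have [/set0Pn [b]|TB0] := boolP (T :&: B != set0).
  rewrite inE => /andP[bT bB]; exists T, pi, pi; rewrite /=.
  split; first by split=> //; exists b.
  split; last by split=> //; left.
  split=> [i|i iS|]; rewrite ?if_same; [exact: onT|exact: offT|].
  under eq_bigr do rewrite if_same.
  by rewrite GE sumr_const; case: full => ->; rewrite ?mul0rn.
have {}TB0 i : i \in T -> i \notin B.
  by move=> iT; apply: contra TB0 => iB; apply/set0Pn; exists i; rewrite inE iT.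
have [TltG|TgeG] := ltnP #|T| G.
  (* The budget is not exhausted, hence free, and any element of the block can
     be added to T. *)
  have pi0 : pi = 0 by case: full => // TE; rewrite TE ltnn in TltG.
  case/set0Pn: Bn0 => b bB; have bS := subsetP BS _ bB.
  exists (b |: T), 0, 0; rewrite /= cardsU1; split.
    split; first by rewrite subUset sub1set bS.
      by apply: leq_trans TltG; rewrite -add1n leq_add2r leq_b1.
    by exists b => //; rewrite !inE eqxx.
  split; last by split; left.
  split=> [i|i iS|]; rewrite ?if_same.
  - by move=> _; exact: w0.
  - by rewrite !inE negb_or -pi0 => /andP[_]; exact: offT.
  - by rewrite mulr0 addr0 big1 // => i _; rewrite if_same.
have TE : #|T| = G by apply/eqP; rewrite eqn_leq TG.
have BneS : B != S.
  have /card_gt0P [i iT] : (0 < #|T|)%N by rewrite TE.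
  by apply: contraNneq (TB0 i iT) => ->; exact: (subsetP TS).
have [b bB bmax] := max_elt w Bn0.
have [T' [pi' [[TS' TG' full'] [piE' onT' offT']]]] :=
  threshold_price (S :\: B) G.-1 w0.
have TB' i : i \in T' -> i \notin B.
  by move=> /(subsetP TS'); rewrite inE => /andP[].
have bT' : b \notin T' by apply: contraL bB; exact: TB'.
(* T' has fewer elements than T, so some element of T lies between the two
   thresholds; the elements of B lie below the first one. *)
have le_pi : w b <= pi'.
  have /subsetPn [j jT jT'] : ~~ (T \subset T').
    apply: contraL TG' => /subset_leq_card.
    by rewrite TE -ltnNge -[in (_ < _)%N]ltnS prednK.
  apply: (@le_trans _ _ pi).
    by apply: offT; [exact: (subsetP BS)|apply: contraL bB; exact: TB0].
  apply: le_trans (onT j jT) _; apply: offT' => //.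
  by rewrite inE (TB0 j jT) (subsetP TS).
exists (b |: T'), pi', (w b); rewrite /= cardsU1 bT'; split.
  split; last by exists b => //; rewrite !inE eqxx.
  - rewrite subUset sub1set (subsetP BS) //=.
    exact: subset_trans TS' (subsetDl _ _).
  - by rewrite -(prednK G0).
split.
  split=> [i|i iS|].
  - by rewrite !inE => /predU1P[->|iT]; rewrite ?bB // (negbTE (TB' i iT)) onT'.
  - rewrite !inE negb_or => /andP[_ iT']; case: ifPn => iB; first exact: bmax.
    by apply: offT' => //; rewrite inE iB.
  - rewrite big_setU1 //= bB addrC; congr (_ + _).
    under eq_bigr => i iT do rewrite (negbTE (TB' i iT)).
    by rewrite sumr_const mulr_natl; case: full' => ->; rewrite ?mul0rn.
split; last by right; split=> //; exists b.
by case: piE' => [->|[i]]; [left|rewrite inE => /andP[_ iS] ->; right; exists i].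
Qed.

(** * The worst case as a minimum of deterministic costs *)

Definition reduced_cost (R : realType) (n : nat) (chat d : 'rV[R]_n)
    (lo hi : nat) (pi sigma : R) : 'rV[R]_n :=
  \row_i (chat 0 i +
    if (lo <= i)%N then Num.max 0 (d 0 i - (if (i < hi)%N then sigma else pi))
    else 0).

Definition dual_objective (R : realType) (n Gamma : nat) (chat d : 'rV[R]_n)
    (lo hi : nat) (pi sigma : R) (x : bits n) : R :=
  Gamma.-1%:R * pi + sigma + cost (reduced_cost chat d lo hi pi sigma) x.

Section Duality.
Variables (R : realType) (n Gamma : nat) (chat d : 'rV[R]_n) (lo hi : nat).
Hypotheses (Gamma_gt0 : (0 < Gamma)%N) (lt_lo_hi : (lo < hi)%N)
  (le_hi_n : (hi <= n)%N).

(** In each coordinate, the gain [delta i * d i * x i] is at most the payment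
    [delta i * p i] plus [max 0 (d i - p i) * x i].  As [sigma <= pi], the
    payments are largest when the budget is exhausted and the block is met
    exactly once. *)
Lemma weak_duality (pi sigma : R) (x : bits n) :
  0 <= sigma -> sigma <= pi ->
  worst_case (uncertainty Gamma chat d lo hi) x <=
  dual_objective Gamma chat d lo hi pi sigma x.
Proof.
move=> sigma0 le_sigma.
have [[c [delta [d0 d1 dG] cE] ->] _] :=
  uncertainty_max chat d x Gamma_gt0 lt_lo_hi le_hi_n.
have delta0 (i : 'I_n) : (i < lo)%N -> delta i = false.
  move=> ilo; move/eqP: d0; rewrite sum_nat_eq0 => /forallP/(_ i).
  by rewrite ilo /=; case: (delta i).
pose p (i : 'I_n) : R := if (i < hi)%N then sigma else pi.
have p0 i : 0 <= p i by rewrite /p; case: ifP => _ //; exact: le_trans le_sigma.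
have payments : \sum_(i < n | (lo <= i)%N) (delta i)%:R * p i <=
    Gamma.-1%:R * pi + sigma.
  rewrite (bigID (fun i : 'I_n => (i < hi)%N)) /=.
  rewrite (eq_bigr (fun i => (delta i)%:R * sigma)); last first.
    by move=> i /andP[_ ih]; rewrite /p ih.
  rewrite [X in _ + X](eq_bigr (fun i => (delta i)%:R * pi)); last first.
    by move=> i /andP[_ /negbTE ih]; rewrite /p ih.
  rewrite -!mulr_suml -!natr_sum.
  move: dG; rewrite (bigID (fun i : 'I_n => (i < hi)%N)) /=.
  move: d1; set a := (\sum_(i < n | _) _)%N; set b := (\sum_(i < n | _) _)%N.
  move=> a1 abG.
  have a1' : 1 <= a%:R :> R by rewrite ler1n.
  have abG' : a%:R + b%:R <= Gamma.-1%:R + 1 :> R.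
    by rewrite -natrD -[1]/(1%:R) -natrD addn1 prednK // ler_nat.
  nra.
rewrite /dual_objective; apply: le_trans (lerD payments (lexx _)).
rewrite /cost [X in _ <= X + _]big_mkcond -big_split /=.
apply: ler_sum => i _; rewrite mxE cE.
have := p0 i; rewrite -/(p i); case: ltnP => [/delta0 ->|_].
  by rewrite mul0r addr0 add0r.
have : 0 <= Num.max 0 (d 0 i - p i) by rewrite le_max lexx.
have : d 0 i - p i <= Num.max 0 (d 0 i - p i) by rewrite le_max lexx orbT.
by case: (x i); case: (delta i) => /=; lra.
Qed.

(** The scenario and the prices come from [optimal_prices] for
    [w i = d i * x i].  As [x] is a 0/1 vector, each [w i] is [0] or [d i], so
    the prices come from a list that does not depend on [x]. *)
Lemma strong_duality (x : bits n) : (forall i, 0 <= d 0 i) ->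
  exists pi sigma : R,
  [/\ dual_objective Gamma chat d lo hi pi sigma x <=
      worst_case (uncertainty Gamma chat d lo hi) x,
      pi = 0 \/ (exists i, pi = d 0 i) &
      sigma = pi \/ [/\ sigma <= pi, hi != n &
        sigma = 0 \/ exists2 i : 'I_n, (lo <= i < hi)%N & sigma = d 0 i]].
Proof.
move=> dge0; pose w i := d 0 i * (x i)%:R.
have w0 i : 0 <= w i by rewrite mulr_ge0.
have wE i : w i = 0 \/ w i = d 0 i.
  by rewrite /w; case: (x i); rewrite ?mulr1 ?mulr0; [right|left].
pose B := [set i : 'I_n | (lo <= i < hi)%N].
pose S := [set i : 'I_n | (lo <= i)%N].
have BS : B \subset S by apply/subsetP => i; rewrite !inE => /andP[].
have B0 : B != set0.
  apply/set0Pn; exists (Ordinal (leq_trans lt_lo_hi le_hi_n)).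
  by rewrite inE /= leqnn.
have [T [pi [sigma [[TS TG [b bT bB]] [[onT offT payments] [piE sigmaE]]]]]] :=
  optimal_prices BS B0 Gamma_gt0 w0.
have pi0 : 0 <= pi by case: piE => [->|[i _ ->]].
have sigma0 : 0 <= sigma by case: sigmaE => [->|[_ _ [i _ ->]]].
have in_S i : i \in T -> (lo <= i)%N by move/(subsetP TS); rewrite inE.
exists pi, sigma; split.
- pose delta : bits n := [ffun i => i \in T].
  have adm : admissible Gamma lo hi delta.
    split.
    + rewrite big1 // => i ilo; rewrite ffunE.
      by case: (boolP (i \in T)) => // /in_S; rewrite leqNgt ilo.
    + rewrite inE in bB; rewrite (bigD1 b) //= ffunE bT.
      exact: leq_addr.
    + apply: leq_trans TG; rewrite -sum1_card big_mkcond [X in (_ <= X)%N]big_mkcond /=.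
      by apply: leq_sum => i _; rewrite ffunE; case: ifP; case: (i \in T).
  pose c : 'rV[R]_n := \row_i (chat 0 i + (delta i)%:R * d 0 i).
  have [_ ub] := uncertainty_max chat d x Gamma_gt0 lt_lo_hi le_hi_n.
  apply: le_trans (ub c _); last by exists delta => // i; rewrite mxE.
  rewrite /dual_objective -payments /cost big_mkcond -big_split /=.
  apply: ler_sum => i _; rewrite !mxE ffunE inE.
  case: (boolP (i \in T)) => [iT|iT].
    have := onT i iT; rewrite inE in_S //= /w.
    set p := if _ then _ else _ => le_w.
    have p0 : 0 <= p by rewrite /p; case: ifP.
    by case: (x i) le_w => /= le_w; case: (leP 0 (d 0 i - p)) => le_dp; lra.
  case: ifPn => [lo_i|_]; last by rewrite add0r mul0r.
  have := offT i; rewrite !inE lo_i /= => /(_ isT iT); rewrite /w.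
  set p := if _ then _ else _ => le_p.
  by case: (x i) le_p => /= le_p; case: (leP 0 (d 0 i - p)) => le_dp; lra.
- case: piE => [|[i _ ->]]; first by left.
  by case: (wE i) => ->; [left|right; exists i].
- case: sigmaE => [|[le_sigma BneS [i iB sigmaE]]]; first by left.
  right; split=> //.
    apply: contraNneq BneS => hin; apply/eqP/setP => j.
    by rewrite !inE hin ltn_ord andbT.
  by rewrite inE in iB; rewrite sigmaE; case: (wE i) => ->; [left|right; exists i].
Qed.

End Duality.

(** * The computation and its number of calls *)

Fixpoint ask_all (Q A B : Type) (qs : seq Q) (f : seq A -> B) :
    oracle_alg Q A B :=
  if qs is q :: qs' then Ask q (fun a => ask_all qs' (fun s => f (a :: s)))
  else Return Q A (f [::]).

Lemma run_ask_all (Q A B : Type) (O : Q -> A) (qs : seq Q) (f : seq A -> B) :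
  run O (ask_all qs f) = f [seq O q | q <- qs].
Proof. by elim: qs f => //= q qs IH f; rewrite IH. Qed.

Lemma ncalls_ask_all (Q A B : Type) (O : Q -> A) (qs : seq Q)
    (f : seq A -> B) :
  ncalls O (ask_all qs f) = size qs.
Proof. by elim: qs f => //= q qs IH f; rewrite IH. Qed.

Definition block (n lo t : nat) : seq 'I_n :=
  [seq i : 'I_n <- enum 'I_n | (lo <= i < lo + t)%N].

Lemma size_block (n lo t : nat) : (size (block n lo t) <= t)%N.
Proof.
rewrite -[leqRHS](size_iota lo) -(size_map val); apply: uniq_leq_size.
  by rewrite (map_inj_uniq val_inj) filter_uniq ?enum_uniq.
by move=> _ /mapP [i + ->]; rewrite mem_filter mem_iota => /andP[].
Qed.

(** Clamping the second price at the first keeps every pair dual feasible. *)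
Definition price_pairs (R : realType) (n : nat) (d : 'rV[R]_n) (lo t : nat) :
    seq (R * R) :=
  let pis := 0 :: [seq d 0 i | i <- enum 'I_n] in
  [seq (pi, pi) | pi <- pis] ++
  [seq (pi, Num.min pi sigma) |
    pi <- pis, sigma <- 0 :: [seq d 0 i | i <- block n lo t]].

Lemma size_price_pairs (R : realType) (n : nat) (d : 'rV[R]_n) (lo t : nat) :
  (size (price_pairs d lo t) <= n.+1 * (2 + t))%N.
Proof.
rewrite size_cat size_allpairs !size_map /= !size_map -enumT size_enum_ord.
by rewrite -mulnS leq_mul2l /= !ltnS size_block.
Qed.

Lemma price_pairs_feasible (R : realType) (n : nat) (d : 'rV[R]_n)
    (lo t : nat) (ps : R * R) :
  (forall i, 0 <= d 0 i) -> ps \in price_pairs d lo t ->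
  0 <= ps.2 /\ ps.2 <= ps.1.
Proof.
move=> d0.
have ge0 s (a : R) : a \in 0 :: [seq d 0 i | i : 'I_n <- s] -> 0 <= a.
  by rewrite inE => /predU1P[->|/mapP[i _ ->]].
rewrite mem_cat => /orP[/mapP[pi /ge0 pi0 ->]|] //.
case/allpairsP=> -[pi sigma] [/= /ge0 pi0 /ge0 sigma0 ->] /=.
by rewrite le_min pi0 sigma0 ge_min lexx.
Qed.

Definition queries (R : realType) (n K : nat) (chat d : 'rV[R]_n) :
    seq 'rV[R]_n :=
  let t := (n %/ K)%N in
  flatten [seq [seq reduced_cost chat d (k * t)
                      (if k.+1 == K then n else (k.+1 * t)%N) ps.1 ps.2
                 | ps <- price_pairs d (k * t) t] | k : 'I_K <- enum 'I_K].

Lemma size_queries (R : realType) (n K : nat) (chat d : 'rV[R]_n) :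
  (size (queries K chat d) <= K * (n.+1 * (2 + n %/ K)))%N.
Proof.
rewrite size_flatten /shape -map_comp sumnE big_map big_enum /=.
rewrite -[X in (_ <= X * _)%N]card_ord -sum_nat_const.
by apply: leq_sum => k _; rewrite /= size_map size_price_pairs.
Qed.

Definition best (R : realType) (n : nat) (f : bits n -> R) (s : seq (bits n)) :
    bits n :=
  [arg min_(y < head [ffun=> false] s in s) f y]%O.

Lemma bestP (R : realType) (n : nat) (f : bits n -> R) (s : seq (bits n)) y :
  y \in s -> best f s \in s /\ f (best f s) <= f y.
Proof.
case: s => // a s ys; rewrite /best.
by case: arg_minP => [|z zs zmin]; [exact: mem_head|split=> //; exact: zmin].
Qed.

(** All answers are feasible, so each set may choose among the answers to the
    queries of all sets without losing feasibility. *)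
Definition heuristic (R : realType) (n K Gamma : nat) (chat d : 'rV[R]_n) :
    oracle_alg 'rV[R]_n (bits n) {ffun 'I_K -> bits n} :=
  ask_all (queries K chat d) (fun s =>
    [ffun k : 'I_K => best (worst_case (U K Gamma chat d k)) s]).

(** The answer to the query whose prices are exact for [x] is as good as [x],
    by weak duality at the same prices. *)
Lemma some_answer_as_good (R : realType) (n K Gamma : nat) (chat d : 'rV[R]_n)
    (X : {set bits n}) (O : 'rV[R]_n -> bits n) (k : 'I_K) (x : bits n) :
  (K <= n)%N -> (0 < Gamma)%N -> (forall i, 0 <= d 0 i) ->
  deterministic_oracle X O -> x \in X ->
  exists2 y, y \in [seq O q | q <- queries K chat d] &
    worst_case (U K Gamma chat d k) y <= worst_case (U K Gamma chat d k) x.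
Proof.
move=> Kn G0 d0 OX xX; have K0 : (0 < K)%N by apply: leq_ltn_trans (ltn_ord k).
rewrite /U; set t := (n %/ K)%N; set hi := (if _ then _ else _).
have t0 : (0 < t)%N by rewrite divn_gt0.
have le_n : (k.+1 * t <= n)%N.
  by apply: leq_trans (leq_divM n K); rewrite mulnC leq_mul2l ltn_ord orbT.
have lt_t : (k * t < k.+1 * t)%N by rewrite ltn_mul2r t0 ltnSn.
have lohi : (k * t < hi)%N by rewrite /hi; case: ifP => // _; exact: leq_trans le_n.
have hin : (hi <= n)%N by rewrite /hi; case: ifP.
have [pi [sigma [exact_x piE sigmaE]]] :=
  strong_duality chat G0 lohi hin x d0.
have ps : (pi, sigma) \in price_pairs d (k * t) t.
  have pi_in : pi \in 0 :: [seq d 0 i | i <- enum 'I_n].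
    case: piE => [->|[i ->]]; rewrite inE ?eqxx //.
    by rewrite map_f ?orbT // mem_enum.
  rewrite mem_cat; apply/orP; case: sigmaE => [->|[le_sigma hi_n sE]].
    by left; apply/mapP; exists pi.
  have hiE : hi = (k * t + t)%N.
    by move: hi_n; rewrite /hi; case: ifP => _; rewrite ?eqxx // mulSn addnC.
  right; apply/allpairsP; exists (pi, sigma); split=> //=; last first.
    by rewrite (min_idPr le_sigma).
  case: sE => [->|[i ilohi ->]]; rewrite inE ?eqxx //.
  by rewrite map_f ?orbT // mem_filter mem_enum -hiE ilohi.
pose q := reduced_cost chat d (k * t) hi pi sigma.
exists (O q).
  apply: map_f; apply/flatten_mapP; exists k; first by rewrite mem_enum.
  by apply/mapP; exists (pi, sigma).
have [sigma0 le_sigma] := price_pairs_feasible d0 ps.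
apply: le_trans (weak_duality chat d G0 lohi hin _ sigma0 le_sigma) _.
apply: le_trans exact_x; rewrite lerD2l.
by have [_] := OX q; exact.
Qed.

Theorem corollary10 (R : realType) :
  exists (C : nat)
         (heuristic : forall n K Gamma : nat, 'rV[R]_n -> 'rV[R]_n ->
            oracle_alg 'rV[R]_n (bits n) {ffun 'I_K -> bits n}),
  forall (n K Gamma : nat) (chat d : 'rV[R]_n),
    (1 <= K <= n)%N -> (1 <= Gamma)%N -> (forall i, 0 <= d 0 i) ->
  forall X : {set bits n}, (exists x, x \in X) ->
  forall O : 'rV[R]_n -> bits n, deterministic_oracle X O ->
    (forall k : 'I_K,
       is_argmin X (worst_case (U K Gamma chat d k))
         (run O (heuristic n K Gamma chat d) k)) /\
    (ncalls O (heuristic n K Gamma chat d) <= C * (K * (2 + n %/ K) * n))%N.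
Proof.
exists 2, (@heuristic R) => n K Gamma chat d /andP[K1 Kn] G1 d0 X [x0 x0X] O OX.
split=> [k|].
  rewrite /heuristic run_ask_all ffunE.
  set s := [seq O q | q <- _]; set f := worst_case _.
  have good x : x \in X -> best f s \in s /\ f (best f s) <= f x.
    move=> xX; have [y ys le_yx] := some_answer_as_good chat k Kn G1 d0 OX xX.
    by have [bs le_by] := bestP f ys; split=> //; exact: le_trans le_yx.
  split; last by move=> x /good[].
  by have [/mapP[q _ ->] _] := good _ x0X; have [] := OX q.
rewrite /heuristic ncalls_ask_all; apply: leq_trans (size_queries K chat d) _.
(* n + 1 <= 2 * n, as n is positive *)
rewrite [leqLHS]mulnCA [(K * _ * n)%N]mulnC [leqRHS]mulnA leq_mul2r.
by rewrite mul2n -addnn -[ltnLHS]addn0 ltn_add2l (leq_trans K1 Kn) orbT.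
Qed.
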